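(* Let $\{X_n : n\ge 0\}$ be vertex-reinforced random walk (VRRW) on $\mathbb{Z}$ started at a fixed vertex $v\in\mathbb{Z}$, and let $R'=\{k\in\mathbb{Z} : X_n=k \text{ for infinitely many } n\}$ be its essential range. Then $\mathbf{P}(|R'|\le 4)=0$.
   Context: $\mathbb{Z}$ is viewed as a graph with $x\sim y$ iff $|x-y|=1$. For a process $X_0,X_1,\ldots$ with values in $\mathbb{Z}$, the augmented occupation numbers are $Z(n,x)=1+\sum_{i=0}^n \mathbf{1}_{X_i=x}$ for $x\in\mathbb{Z}$, $n\ge0$. Let $\mathcal{F}_n=\sigma(X_0,\ldots,X_n)$. Vertex-reinforced random walk (VRRW) on $\mathbb{Z}$ with starting point $v$ is the process with $X_0=v$ and $$\mathbf{P}(X_{n+1}=x\mid \mathcal{F}_n)=\mathbf{1}_{x\sim X_n}\,\frac{Z(n,x)}{\sum_{w\sim X_n}Z(n,w)}.$$ *)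

(* Defs.v *)
From HB Require Import structures.
From mathcomp Require Import all_boot all_order all_algebra.
From mathcomp Require Import all_classical all_reals all_analysis.
Set Implicit Arguments.
Unset Strict Implicit.
Unset Printing Implicit Defensive.
Import Order.TTheory GRing.Theory Num.Theory.
Import numFieldNormedType.Exports.
Local Open Scope classical_set_scope.
Local Open Scope ring_scope.

(* The library puts the discrete sigma-algebra on unit, bool and nat only; with
   these instances, {RV P >-> int} is the type of Z-valued random variables. *)
HB.instance Definition _ := isPointed.Build int 0.
HB.instance Definition _ := @isMeasurable.Build default_measure_display
  int discrete_measurable discrete_measurable0
  discrete_measurableC discrete_measurableU.

Definition Z_adjacent : rel int := [rel x y | `|x - y| == 1].

Section cond_prob.
Context d (T : measurableType d) (R : realType) (P : probability T R).

(* Y is a version of P(E | G), for a sub-sigma-algebra G. *)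
Definition is_cond_prob (G : set (set T)) (E : set T) (Y : T -> R) : Prop :=
  [/\ forall B : set R, measurable B -> G (Y @^-1` B),
      P.-integrable [set: T] (EFin \o Y) &
      forall A, G A -> (\int[P]_(w in A) (Y w)%:E = P (E `&` A))%E].

End cond_prob.

Section vrrw.
Context d (T : measurableType d) (R : realType) (P : probability T R).
Variable X : nat -> {RV P >-> int}.

Definition natural_filtration (n : nat) : set (set T) :=
  g_sigma_preimage (fun i : 'I_n.+1 => X i : T -> int).

Definition aug_occupation (n : nat) (x : int) (w : T) : nat :=
  (1 + \sum_(i < n.+1) (X i w == x))%N.

Definition vrrw_kernel (n : nat) (x : int) (w : T) : R :=
  (Z_adjacent x (X n w))%:R *
  ((aug_occupation n x w)%:R /
   \sum_(y \in [set y | Z_adjacent y (X n w)]) ((aug_occupation n y w)%:R : R)).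

Definition is_vrrw (v : int) : Prop :=
  {ae P, forall w, X 0%N w = v} /\
  forall n x, is_cond_prob P (natural_filtration n)
                (X n.+1 @^-1` [set x]) (vrrw_kernel n x).

Definition essential_range (w : T) : set int :=
  [set k | infinite_set [set n | X n w = k]].

End vrrw.

(* Main.v *)
Require Import Defs.
From mathcomp Require Import all_boot all_order all_algebra finmap.
From mathcomp Require Import all_classical all_reals all_analysis.
From mathcomp Require Import zify ring lra.
Set Implicit Arguments.
Unset Strict Implicit.
Unset Printing Implicit Defensive.
Import Order.TTheory GRing.Theory Num.Theory.
Import numFieldNormedType.Exports.
Local Open Scope classical_set_scope.
Local Open Scope card_scope.
Local Open Scope ring_scope.

(* Everything is done with nonnegative functions V of the past path that are
   supermartingales while the walk stays in some domain; by the maximal inequality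
   V almost surely stays bounded on the event that the domain is never left.

   If the walk stays in {p,p+1,p+2}, V = Z(p+1) is a supermartingale but tends to
   infinity. If it stays in {p,..,p+3} and has visited p, V = Z(p+2) / (Z(p) - 1) is
   a supermartingale, hence Z(p+2) <= C (Z(p) - 1) and Z(p+1) = O(Z(p)); the risk of
   jumping from p to p-1 is then at least of order 1/Z(p), and the corresponding sum
   diverges. So eventual confinement to four sites has probability 0.

   It remains to exclude that R' is empty, which forces the walk to be unbounded.
   When the walk first visits y, the probability that it ever reaches y+3 is at
   most 281/288, uniformly in the past: with conditional probability at least 1/8
   the visit to y+1 happens late, with Z(y) >= 5, if at all, and after that the
   explicit supermartingale phi below, at most 29/36 at that time, dominates the
   probability of reaching y+3. *)

(** * Nearest-neighbour paths and occupation numbers *)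

(* Paths are listed backwards: the head of the list is the current site. *)
Definition occ (s : seq int) (y : int) : nat := (count_mem y s).+1.

Definition hd (s : seq int) : int := head 0 s.

Fixpoint nnpath (v : int) (s : seq int) : bool :=
  if s is x :: t then
    if t is z :: _ then Z_adjacent x z && nnpath v t else x == v
  else false.

Definition pmax (v : int) (s : seq int) : int := foldr Num.max v s.

Lemma occ_cons (x : int) (s : seq int) (y : int) : occ (x :: s) y = ((x == y) + occ s y)%N.
Proof. by rewrite /occ /= addnS. Qed.

Lemma occ_gt0 s y : (0 < occ s y)%N.
Proof. by []. Qed.

Lemma adjP (x y : int) : Z_adjacent x y = (x == y + 1) || (x == y - 1).
Proof. by rewrite /Z_adjacent /=; lia. Qed.

Lemma nnpath_cons v x s : nnpath v s -> nnpath v (x :: s) = Z_adjacent x (hd s).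
Proof. by case: s => //= z s ->; rewrite andbT. Qed.

Lemma nnpath_ind v (Q : seq int -> Prop) :
  Q [:: v] ->
  (forall (s : seq int) (x : int), nnpath v s -> Q s -> x = hd s + 1 \/ x = hd s - 1 ->
     Q (x :: s)) ->
  forall s, nnpath v s -> Q s.
Proof.
move=> Q0 QS; elim => // x [|z s] IH; first by move=> /= /eqP ->.
move=> /andP[+ hs]; rewrite adjP => h.
by apply: QS => //; [exact: IH | case/orP: h => /eqP; [left | right]].
Qed.

(* Each visit to y is preceded by a visit to one of its neighbours. *)
Lemma occ_neighbors (v : int) (s : seq int) (y : int) : nnpath v s ->
  (occ s y + ((hd s == y - 1)%R || (hd s == y + 1)%R) <=
   occ s (y - 1)%R + occ s (y + 1)%R)%N.
Proof.
move: s; apply: nnpath_ind => [|s x _ IH hx]; first by rewrite /occ /=; lia.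
by rewrite !occ_cons /=; move: IH hx; lia.
Qed.

Lemma pmax_cons v x s : pmax v (x :: s) = Num.max x (pmax v s).
Proof. by []. Qed.

Lemma head_pmax (v : int) (s : seq int) : nnpath v s -> hd s <= pmax v s.
Proof. by case: s => // x s _; rewrite pmax_cons /=; lia. Qed.

(** A nearest-neighbour path skips no site between [v] and its maximum, and [occ] starts from 1. *)
Lemma occ_visited (v : int) (s : seq int) (z : int) :
  nnpath v s -> v <= z -> z <= pmax v s -> (1 < occ s z)%N.
Proof.
move=> + vz; move: s; apply: nnpath_ind.
  by rewrite /occ /=; lia.
move=> s x hs IH hx; rewrite pmax_cons occ_cons.
by have := head_pmax hs; have := occ_gt0 s z; move: IH hx; lia.
Qed.

Lemma occ_unvisited (v : int) (s : seq int) (z : int) : nnpath v s -> pmax v s < z -> occ s z = 1%N.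
Proof.
move: s; apply: nnpath_ind.
  by rewrite /occ /=; lia.
move=> s x hs IH hx; rewrite pmax_cons occ_cons.
by move: IH hx; lia.
Qed.

Definition killed (R : pzRingType) (D : pred (seq int)) (V : seq int -> R) (s : seq int) : R :=
  if D s then V s else 0.

(* [V], set to 0 once the walk leaves [D], is a supermartingale under the VRRW
   dynamics; the normalising denominator is cleared. *)
Definition superharmonic (R : numDomainType) (D : pred (seq int)) (V : seq int -> R) :=
  forall t, D t -> let x := hd t in
    (occ t (x + 1))%:R * killed D V (x + 1 :: t) +
    (occ t (x - 1))%:R * killed D V (x - 1 :: t) <=
    V t * ((occ t (x + 1))%:R + (occ t (x - 1))%:R).

(** * Inequalities for the climbing supermartingale *)

Section inequalities.
Context (R : realFieldType).
Implicit Types a b c e : R.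

(** With [c], [b], [a], [e] the occupation numbers of [y - 1], [y], [y + 1], [y + 2], the ratios
    [e / (b - 1)] and [a / (c - 1)] are the martingales of the urns at [y + 1] and at [y]. *)
Definition phi0 c b a e : R := e / (b - 1) * (1 + a / (c - 1)).

Lemma phi0_ge0 c b a e : 1 < c -> 1 < b -> 0 <= a -> 0 <= e -> 0 <= phi0 c b a e.
Proof.
move=> hc hb ha he; apply: mulr_ge0; first by apply: divr_ge0; lra.
by apply: addr_ge0 => //; apply: divr_ge0; lra.
Qed.

Lemma phi0_left c b a e : 1 < c -> 1 < b -> 0 <= a -> 0 <= e ->
  phi0 (c + 1) b a e <= phi0 c b a e.
Proof.
move=> hc hb ha he; apply: ler_wpM2l; first by apply: divr_ge0; lra.
by rewrite lerD2l; apply: ler_wpM2l => //; rewrite lef_pV2 ?posrE; lra.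
Qed.

(** A jump to the left counts the return to [y] in advance. Raising [b] frees
    [e (a + c) / (b (b - 1)) >= e / b], which pays the charge due on arrival at [y + 1]. *)
Lemma phi0_at c b a e : 1 < c -> 1 < b -> 0 < a -> 0 < e -> b - 1 <= a + c ->
  a * (phi0 c b (a + 1) e + e / ((b + e) * (a + 2))) +
  c * phi0 (c + 1) (b + 1) a e <= phi0 c b a e * (a + c).
Proof.
move=> hc hb ha he hbac.
have -> : phi0 c b a e * (a + c) = a * phi0 c b (a + 1) e +
   c * phi0 (c + 1) (b + 1) a e + (e / (b * (b - 1))) * (c + a).
  rewrite /phi0; field; repeat (apply/andP; split); lra.
rewrite mulrDr addrAC lerD2l.
have -> : a * (e / ((b + e) * (a + 2))) = e * ((a / (a + 2)) / (b + e)).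
  field; apply/andP; split; lra.
rewrite -[leRHS]mulrA ler_pM2l // ler_pdivrMr; last lra.
apply: (@le_trans _ _ 1); first by rewrite ler_pdivrMr; lra.
rewrite -mulrA mulrC ler_pdivlMr ?mul1r; last by apply: mulr_gt0; lra.
nra.
Qed.

(** The charge at [y + 1] is the jump probability [e / (b + e)] times the charge at [y + 2]. *)
Lemma phi0_urn c b a e : 1 < c -> 1 < b -> 0 < a -> 0 < e ->
  e * (phi0 c b a (e + 1) + 1 / (a + 1)) + b * phi0 c (b + 1) a e =
  (phi0 c b a e + e / ((b + e) * (a + 1))) * (e + b).
Proof.
move=> *; rewrite /phi0; field; repeat (apply/andP; split); lra.
Qed.

(** The charge [1 / (a + 1)] is exactly the risk of jumping to the fresh site [y + 3]. Losing [phi0]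
    there outweighs the growth of [a] by [e / (b - 1)], enough for the new charge at [y + 1]. *)
Lemma phi0_exit c b a e : 1 < c -> 1 < b -> 0 < a -> 0 < e ->
  1 + a * (phi0 c b (a + 1) e + e / ((b + e) * (a + 2))) <=
  (phi0 c b a e + 1 / (a + 1)) * (1 + a).
Proof.
move=> hc hb ha he.
have -> : (phi0 c b a e + 1 / (a + 1)) * (1 + a) =
   1 + a * phi0 c b (a + 1) e + e / (b - 1).
  rewrite /phi0; field; repeat (apply/andP; split); lra.
rewrite mulrDr addrA lerD2l.
have -> : a * (e / ((b + e) * (a + 2))) = e * ((a / (a + 2)) / (b + e)).
  field; apply/andP; split; lra.
rewrite ler_pM2l // ler_pdivrMr; last lra.
apply: (@le_trans _ _ 1); first by rewrite ler_pdivrMr; lra.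
rewrite mulrC ler_pdivlMr; lra.
Qed.

(** Truncation at 1 is monotone and concave. *)
Lemma min1_mix r l u w V : 0 <= r -> 0 <= l -> r * u + l * w <= V * (r + l) ->
  r * Num.min 1 u + l * Num.min 1 w <= Num.min 1 V * (r + l) :> R.
Proof.
move=> hr hl h; rewrite [leRHS]mulrC [leRHS]minr_pMr ?addr_ge0 // le_min; apply/andP; split.
  by rewrite mulr1 lerD // ler_piMr // ge_min lexx.
by rewrite [leRHS]mulrC; apply: le_trans h; rewrite lerD // ler_wpM2l // ge_min lexx orbT.
Qed.

(* 7/36 = 1 - 29/36 bounds from below the probability of success once Z(y) >= 5, and
   each visit to y before that is followed by a premature jump to y+1 with
   probability at most 1/2. *)
Definition warm (n : nat) : R := 1 - (7 / 36) / 2 ^+ (5 - n).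

Lemma warm_ge0 n : 0 <= warm n.
Proof.
rewrite /warm subr_ge0 ler_pdivrMr ?exprn_gt0 // mul1r.
by apply: (@le_trans _ _ 1); [lra | rewrite exprn_ege1 // ler1n].
Qed.

Lemma warm_step (b c : nat) : (1 < b)%N -> (1 < c)%N ->
  Num.min 1 (phi0 c%:R b%:R 2 1 + 1 / ((b%:R + 1) * (2 + 1))) +
  c%:R * warm b.+1 <= warm b * (1 + c%:R).
Proof.
move=> hb hc.
have hc' : 2 <= c%:R :> R by rewrite (ler_nat _ 2).
have [b5|b5] := leqP 5 b.
  have e0 : (5 - b = 0)%N by lia.
  have e1 : (5 - b.+1 = 0)%N by lia.
  rewrite /warm e0 e1.
  rewrite expr0 divr1 [_ * (1 + _)]mulrDr mulr1 [_ * c%:R]mulrC lerD2r.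
  have hb' : 5 <= b%:R :> R by rewrite (ler_nat _ 5).
  (* From [b >= 5] and [c >= 2] the bound is [1 / 4 * 3 + 1 / 18 = 29 / 36]. *)
  rewrite ge_min; apply/orP; right; rewrite /phi0.
  set B : R := b%:R in hb' *; set C : R := c%:R in hc' *.
  have h1 : 1 / (B - 1) <= 1 / 4 by rewrite ler_pdivrMr; lra.
  have h2 : 2 / (C - 1) <= 2 by rewrite ler_pdivrMr; lra.
  have h0 : 0 <= 2 / (C - 1) :> R by apply: divr_ge0; lra.
  have h3 : 1 / ((B + 1) * (2 + 1)) <= 1 / 18 by rewrite ler_pdivrMr; lra.
  have h4 : 1 / (B - 1) * (1 + 2 / (C - 1)) <= 1 / 4 * 3.
    by apply: ler_pM; try lra; apply: divr_ge0; lra.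
  lra.
have e0 : (5 - b = (5 - b.+1).+1)%N by lia.
rewrite /warm e0.
(* A premature jump is charged the trivial bound 1. Halving the gap to 1 suffices because
   [(1 + c) / 2 <= c]. *)
apply: (@le_trans _ _ (1 + c%:R * (1 - 7 / 36 / 2 ^+ (5 - b.+1)))).
  by rewrite lerD2r ge_min lexx.
have : 0 < (2 ^+ (5 - b.+1))^-1 :> R by rewrite invr_gt0 exprn_gt0.
rewrite exprS invfM; set q := _^-1 => hq.
have : q <= c%:R * q / 2 by nra.
set C : R := c%:R in hc' *.
have -> : 7 / 36 * (2^-1 * q) = 7 / 72 * q by field.
nra.
Qed.

End inequalities.

(** * Supermartingales for walks confined to three or four sites *)

Section windows.
Context (R : realFieldType).
Implicit Types (t : seq int) (p v : int) (C : nat).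

Definition window3 p t := (p <= hd t) && (hd t <= p + 2).

(** At either end the walk is killed with weight at least 1 or else raises [Z(p + 1)] by one, and
    [Z (Z + 1) <= Z (Z + z)] for [z >= 1]. Jumps from the middle change nothing. *)
Lemma superharmonic_window3 p :
  superharmonic (window3 p) (fun t => (occ t (p + 1))%:R : R).
Proof.
move=> t Dt /=; set x := hd t.
have key q :
    (occ t (p + 1))%:R * ((occ t (p + 1)).+1)%:R <=
    (occ t (p + 1))%:R * ((occ t (p + 1))%:R + (occ t q)%:R) :> R.
  rewrite ler_wpM2l // -natrD ler_nat.
  by have := occ_gt0 t q; lia.
have : x = p \/ x = p + 1 \/ x = p + 2 by move: Dt; rewrite /window3 -/x; lia.
rewrite /killed /window3 !occ_cons => -[->|[->|->]] /=.
- have -> : (p <= p + 1 <= p + 2) = true by lia.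
  have -> : (p <= p - 1 <= p + 2) = false by lia.
  rewrite eqxx mulr0 addr0 add1n; exact: key.
- have -> : (p <= p + 1 + 1 <= p + 2) = true by lia.
  have -> : (p <= p + 1 - 1 <= p + 2) = true by lia.
  have -> : (p + 1 + 1 == p + 1) = false by lia.
  have -> : (p + 1 - 1 == p + 1) = false by lia.
  by rewrite !add0n -mulrDl mulrC.
- have -> : (p <= p + 2 + 1 <= p + 2) = false by lia.
  have -> : (p <= p + 2 - 1 <= p + 2) = true by lia.
  have -> : p + 2 - 1 = p + 1 by lia.
  rewrite eqxx mulr0 add0r add1n [X in _ <= _ * X]addrC; exact: key.
Qed.

Definition window4 p t := (p <= hd t) && (hd t <= p + 3).

Lemma window4P p t : window4 p t ->
  [\/ hd t = p, hd t = p + 1, hd t = p + 2 | hd t = p + 3].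
Proof.
rewrite /window4 => ht.
have : hd t = p \/ hd t = p + 1 \/ hd t = p + 2 \/ hd t = p + 3 by lia.
by case=> [|[|[|]]] ->; [constructor 1|constructor 2|constructor 3|constructor 4].
Qed.

Lemma killed_le (D : pred (seq int)) (V : seq int -> R) t : 0 <= V t -> killed D V t <= V t.
Proof. by rewrite /killed; case: ifP. Qed.

Lemma mix_le (r l u w V : R) : 0 <= r -> 0 <= l -> u <= V -> w <= V ->
  r * u + l * w <= V * (r + l).
Proof. by move=> r0 l0 uV wV; rewrite [leRHS]mulrC mulrDl lerD // ler_wpM2l. Qed.

(* The urn at [p + 1] makes [Z(p + 2) / (Z(p) - 1)] a martingale, and the jump
   from [p + 3] to [p + 2] is paid for by the risk of leaving to [p + 4]. *)
Lemma superharmonic_ratio p :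
  superharmonic (fun t => window4 p t && (1 < occ t p)%N)
    (fun t => (occ t (p + 2))%:R / ((occ t p)%:R - 1) : R).
Proof.
move=> t /andP[ht hp] /=; set D := fun t => _; set V := fun t => _.
have a2 : 2 <= (occ t p)%:R :> R by rewrite (ler_nat _ 2).
have c1 : 1 <= (occ t (p + 2))%:R :> R by rewrite (ler_nat _ 1).
have V0 u : (1 < occ u p)%N -> 0 <= V u.
  by move=> hu; rewrite divr_ge0 // subr_ge0 (ler_nat _ 1) ltnW.
have kV y : killed D V (y :: t) <= V (y :: t).
  by apply/killed_le/V0; rewrite occ_cons; lia.
have same (y : int) : y != p -> y != p + 2 -> killed D V (y :: t) <= V t.
  move=> h1 h2; apply: le_trans (kV y) _; rewrite /V !occ_cons.
  by rewrite (negbTE h1) (negbTE h2) !add0n.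
have dead y : ~~ window4 p (y :: t) -> killed D V (y :: t) = 0.
  by move=> hy; rewrite /killed /D (negbTE hy).
have V0t := V0 t hp.
case: (window4P ht) => ->.
- apply: mix_le => //; first by apply: same; lia.
  by rewrite dead // /window4 /=; lia.
- have h1 := kV (p + 1 + 1); have h2 := kV (p + 1 - 1).
  apply: le_trans (lerD (ler_wpM2l _ h1) (ler_wpM2l _ h2)) _ => //.
  rewrite /V !occ_cons (_ : p + 1 + 1 = p + 2) 1?(_ : p + 1 - 1 = p); [|lia..].
  rewrite !eqxx (_ : (p + 2 == p) = false) 1?(_ : (p == p + 2) = false); [|lia..].
  rewrite !natrD /= !mulr0n !mulr1n !add0r.
  move: (occ t p)%:R (occ t (p + 2))%:R a2 c1 => a c a2 c1.
  rewrite le_eqVlt; apply/orP; left; apply/eqP; field; repeat (apply/andP; split); lra.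
- by apply: mix_le => //; apply: same; lia.
- rewrite [killed _ _ (p + 3 + 1 :: t)]dead; last by rewrite /window4 /=; lia.
  have h := kV (p + 3 - 1); rewrite mulr0 add0r.
  apply: le_trans (ler_wpM2l _ h) _ => //.
  rewrite /V !occ_cons (_ : p + 3 - 1 = p + 2); [|lia].
  rewrite !eqxx (_ : (p + 2 == p) = false); [|lia].
  rewrite !natrD /= mulr0n mulr1n add0r mulrA mulrAC. apply: ler_wpM2l; first exact: V0t.
  by rewrite lerD2r (ler_nat _ 1).
Qed.

(** A multiple of the harmonic sum, shifted by 1 so that killing the walk always forfeits at least
    1. *)
Definition slow_harmonic C k : R := 1 + \sum_(i < k) ((C.+1)%:R * (i.+1)%:R)^-1.

Lemma slow_harmonicS C k :
  slow_harmonic C k.+1 = slow_harmonic C k + ((C.+1)%:R * (k.+1)%:R)^-1.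
Proof. by rewrite /slow_harmonic big_ord_recr /= addrA. Qed.

Lemma slow_harmonic_ge1 C k : 1 <= slow_harmonic C k.
Proof. by rewrite lerDl sumr_ge0. Qed.

(** Leaving [p] to the right adds [1 / ((C + 1) Z(p))]. As [Z(p + 1) <= (C + 1) Z(p)], this gain has
    weighted size at most 1 and is paid by the killed jump to [p - 1]. Subtracting [hd t == p] moves
    the increment from arrival to departure. *)
Lemma superharmonic_departures v p C :
  superharmonic
    (fun t => [&& nnpath v t, window4 p t & (occ t (p + 2) <= C * (occ t p).-1)%N])
    (fun t => slow_harmonic C (occ t p - (hd t == p))).
Proof.
move=> t /and3P[hv ht hC] /=; set D := fun t => _; set V := fun t => _.
have V0 u : 0 <= V u by exact: le_trans (slow_harmonic_ge1 _ _).
have same (y : int) : hd t != p -> killed D V (y :: t) <= V t.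
  move=> hp; apply: le_trans (killed_le _ (V0 _)) _.
  rewrite /V occ_cons /= (negbTE hp) subn0.
  by case: (y == p); rewrite ?subn0 ?add0n //= add1n subn1.
have [hp|hp] : hd t = p \/ hd t != p by case: eqP; [left|right].
  2: by apply: mix_le => //; exact: same.
rewrite hp [killed _ _ (p - 1 :: t)](_ : _ = 0); last first.
  by rewrite /killed /D /window4 /= (_ : (p <= p - 1) = false) ?andbF //; lia.
have hk : killed D V (p + 1 :: t) <= slow_harmonic C (occ t p).
  apply: le_trans (killed_le _ (V0 _)) _.
  rewrite /V occ_cons /= (_ : (p + 1 == p) = false) ?add0n ?subn0 //; lia.
rewrite mulr0 addr0; apply: le_trans (ler_wpM2l _ hk) _ => //.
rewrite /V eqxx subn1.
have a2 : (occ t (p + 1) <= C.+1 * occ t p)%N.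
  have := occ_neighbors (p + 1) hv.
  have -> : p + 1 - 1 = p by lia.
  have -> : p + 1 + 1 = p + 2 by lia.
  by have := occ_gt0 t (p + 2); move: hC; case: (occ t p) => [|n] /=; nia.
case: (occ t p) a2 (occ_gt0 t p) => // a a2 _; rewrite slow_harmonicS /=.
have h1 : 1 <= (occ t (p - 1))%:R :> R by rewrite (ler_nat _ 1).
have hs := slow_harmonic_ge1 C a.
set b : R := (occ t (p + 1))%:R; set s := slow_harmonic C a in hs *.
have : b * ((C.+1)%:R * (a.+1)%:R)^-1 <= 1.
  by rewrite ler_pdivrMr ?mulr_gt0 // mul1r -natrM ler_nat.
have b0 : 0 <= b by [].
set z := (occ t (p - 1))%:R in h1 *.
set q := _^-1; nra.
Qed.

End windows.

(** * The supermartingale that controls upward climbs *)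

Ltac decide_int :=
  repeat match goal with
  | |- context[@eq_op ?T ?a ?b] =>
    first [ have -> : @eq_op T a b = false by clear; lia
          | have -> : @eq_op T a b = true by clear; lia ]
  | |- context[@Order.lt ?d ?T ?a ?b] =>
    first [ have -> : @Order.lt d T a b = false by clear; lia
          | have -> : @Order.lt d T a b = true by clear; lia ]
  end.

Section climbing.
Context (R : realFieldType).
Implicit Types (t : seq int) (v y z : int).

(* Bounds the probability of reaching [y + 3] once [y + 1] has been reached. The
   second summand is the risk of the jump from [y + 2] to [y + 3], charged
   already at [y + 1]; a stay to the left of [y] counts as a visit to [y]. *)
Definition phi y t : R :=
  phi0 (occ t (y - 1))%:R (occ t y + (hd t < y)%R)%:R (occ t (y + 1))%:R (occ t (y + 2))%:R +
  if hd t == y + 1 then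
    (occ t (y + 2))%:R / (((occ t y)%:R + (occ t (y + 2))%:R) * ((occ t (y + 1))%:R + 1))
  else if hd t == y + 2 then 1 / ((occ t (y + 1))%:R + 1) else 0.

Definition phi_exit y t : R := if hd t == y + 3 then 1 else phi y t.

(** One case per position: to the left of [y] the value does not increase; at [y], [y + 1], [y + 2]
    the claim is [phi0_at], [phi0_urn], [phi0_exit]. *)
Lemma phi_step v y t : nnpath v t -> v < y -> y < pmax v t -> pmax v t < y + 3 ->
  let x := hd t in
  (occ t (x + 1))%:R * phi_exit y (x + 1 :: t) + (occ t (x - 1))%:R * phi_exit y (x - 1 :: t)
   <= phi y t * ((occ t (x + 1))%:R + (occ t (x - 1))%:R).
Proof.
move=> ht vy ym my /=.
have hc : (1 < occ t (y - 1))%N by apply: (@occ_visited v) => //; lia.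
have hb : (1 < occ t y)%N by apply: (@occ_visited v) => //; lia.
have ha : (1 < occ t (y + 1))%N by apply: (@occ_visited v) => //; lia.
have he : (0 < occ t (y + 2))%N by [].
have hbac : (occ t y <= occ t (y - 1)%R + occ t (y + 1)%R)%N.
  by have := occ_neighbors y ht; lia.
have hx := head_pmax ht.
have hx3 : occ t (y + 3) = 1%N by apply: (@occ_unvisited v).
have hc' : 2 <= (occ t (y - 1))%:R :> R by rewrite (ler_nat _ 2).
have hb' : 2 <= (occ t y)%:R :> R by rewrite (ler_nat _ 2).
have ha' : 2 <= (occ t (y + 1))%:R :> R by rewrite (ler_nat _ 2).
have he' : 1 <= (occ t (y + 2))%:R :> R by rewrite (ler_nat _ 1).
have hbac' : (occ t y)%:R <= (occ t (y - 1))%:R + (occ t (y + 1))%:R :> R.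
  by rewrite -natrD ler_nat.
have left z : z <= y -> hd t < y -> phi_exit y (z :: t) <= phi y t.
  move=> zy ty; rewrite /phi_exit /phi /= !occ_cons.
  have -> : (z == y + 3) = false by lia.
  have -> : (z == y + 1) = false by lia.
  have -> : (z == y + 2) = false by lia.
  have -> : (hd t == y + 1) = false by lia.
  have -> : (hd t == y + 2) = false by lia.
  rewrite !add0n !addr0 ty.
  (* Stepping back onto [y] turns the visit counted in advance into a real one. *)
  have -> : ((z == y) + occ t y + (z < y)%R)%N = (occ t y + true)%N by lia.
  case: (z == y - 1); rewrite ?add0n //.
  rewrite natrD addrC; apply: phi0_left => //; try lra.
  by rewrite (ltr_nat _ 1); lia.
have cases : hd t < y \/ hd t = y \/ hd t = y + 1 \/ hd t = y + 2 by lia.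
case: cases => [hy|[hy|[hy|hy]]].
- by apply: mix_le => //; apply: left => //; lia.
- rewrite hy /phi_exit /phi /= hy !occ_cons.
  decide_int.
  rewrite !natrD /= !mulr1n !mulr0n !add0r !addr0.
  have -> : 1 + (occ t (y + 1))%:R + 1 = (occ t (y + 1))%:R + 2 :> R by lra.
  rewrite ![1 + _]addrC.
  apply: phi0_at; lra.
- rewrite hy /phi_exit /phi /= hy !occ_cons.
  have -> : y + 1 + 1 = y + 2 by lia.
  have -> : y + 1 - 1 = y by lia.
  decide_int.
  rewrite !natrD /= !mulr1n !mulr0n !add0r !addr0.
  rewrite ![1 + _]addrC.
  rewrite le_eqVlt phi0_urn ?eqxx //; lra.
- rewrite hy /phi_exit /phi /= hy !occ_cons.
  have -> : y + 2 + 1 = y + 3 by lia.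
  have -> : y + 2 - 1 = y + 1 by lia.
  rewrite hx3.
  decide_int.
  rewrite !natrD /= !mulr1n !mulr0n !add0r !addr0 !mulr1.
  have -> : 1 + (occ t (y + 1))%:R + 1 = (occ t (y + 1))%:R + 2 :> R by lra.
  rewrite [X in phi0 _ _ X _ + _]addrC.
  apply: phi0_exit; lra.
Qed.

(* The walk is on its way from the first visit to [y] to the first visit to
   [y + 3]; before the first visit to [y + 1] the only favourable outcome is that
   [Z(y) >= 5] at that visit. *)
Definition block v y t : R :=
  if pmax v t == y then warm R (occ t y + (hd t < y)%R) else Num.min 1 (phi y t).

Definition block_exit v y t : R := if hd t == y + 3 then 1 else block v y t.

(** After the first visit to [y + 1] this is [phi_step] truncated at 1. Before it, only a jump from
    [y] matters; [y + 1] and [y + 2] are still fresh then, so [warm_step] applies. *)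
Lemma block_step v y t : nnpath v t -> v < y -> y <= pmax v t -> pmax v t < y + 3 ->
  let x := hd t in
  (occ t (x + 1))%:R * block_exit v y (x + 1 :: t) +
  (occ t (x - 1))%:R * block_exit v y (x - 1 :: t)
   <= block v y t * ((occ t (x + 1))%:R + (occ t (x - 1))%:R).
Proof.
move=> ht vy; rewrite le_eqVlt => /orP[/eqP ym|ym] my /=; last first.
  have E z : block_exit v y (z :: t) = Num.min 1 (phi_exit y (z :: t)).
    rewrite /block_exit /phi_exit /block; case: ifP => _; first by rewrite minxx.
    by rewrite pmax_cons (_ : (Num.max z _ == y) = false) //; lia.
  rewrite !E /block (_ : (pmax v t == y) = false); last by lia.
  by apply: min1_mix => //; apply: phi_step ym my.
have hx := head_pmax ht.
have left z : z <= y -> z = hd t + 1 \/ z = hd t - 1 ->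
    block_exit v y (z :: t) = warm R (occ t y).+1.
  move=> zy hz; rewrite /block_exit /block pmax_cons occ_cons /=.
  have -> : (z == y + 3) = false by lia.
  have -> : (Num.max z (pmax v t) == y) = true by lia.
  by congr warm; lia.
have -> : block v y t = warm R (occ t y + (hd t < y)%R) by rewrite /block -ym eqxx.
have [hy|hy] : hd t < y \/ hd t = y by lia.
  by rewrite !left ?hy ?addn1; [apply: mix_le | lia | right | lia | left].
rewrite hy ltxx addn0 [block_exit _ _ (y - 1 :: t)]left ?hy; [|lia|by right].
have hc : (1 < occ t (y - 1))%N by apply: (@occ_visited v) => //; lia.
have hb : (1 < occ t y)%N by apply: (@occ_visited v) => //; lia.
have h1 : occ t (y + 1) = 1%N by apply: (@occ_unvisited v) => //; lia.
have h2 : occ t (y + 2) = 1%N by apply: (@occ_unvisited v) => //; lia.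
have -> : block_exit v y (y + 1 :: t) =
    Num.min 1 (phi0 (occ t (y - 1))%:R (occ t y)%:R 2 1 + 1 / (((occ t y)%:R + 1) * (2 + 1))).
  rewrite /block_exit /block /phi pmax_cons !occ_cons /= h1 h2.
  have -> : (Num.max (y + 1) (pmax v t) == y) = false by lia.
  by decide_int; rewrite !addn0.
by rewrite h1 !mul1r; have := @warm_step R _ _ hb hc; rewrite mul1r.
Qed.

(** Blocks start at [v + 1], [v + 4], ..., and [j] counts the completed ones. The factor [288 / 281]
    is the inverse of [warm 2], the value of a block at its first visit. *)
Definition climb v t : R :=
  let j := (`|pmax v t - (v + 1)%R| %/ 3)%N in
  (288 / 281) ^+ j * block v (v + 1 + (j * 3)%:Z) t.

Lemma warm2 : warm R 2 = 281 / 288.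
Proof. by rewrite /warm; lra. Qed.

Lemma block_ge0 v y t : v < y -> nnpath v t -> y <= pmax v t -> 0 <= block v y t.
Proof.
move=> vy ht; rewrite le_eqVlt => /orP[/eqP ->|ym]; rewrite /block ?eqxx ?warm_ge0 //.
rewrite (_ : (pmax v t == y) = false); last lia.
rewrite le_min ler01 /=; apply: addr_ge0.
  have hc : (1 < occ t (y - 1))%N by apply: (@occ_visited v) => //; lia.
  have hb : (1 < occ t y)%N by apply: (@occ_visited v) => //; lia.
  by apply: phi0_ge0; rewrite ?ler0n // (ltr_nat _ 1) //; lia.
case: ifP => _; first by rewrite divr_ge0 ?mulr_ge0 ?addr_ge0.
by case: ifP => _ //; rewrite divr_ge0 ?addr_ge0.
Qed.

Lemma climb_ge0 v t : nnpath v t -> v < pmax v t -> 0 <= climb v t.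
Proof.
move=> ht hm; rewrite /climb; set j := (_ %/ 3)%N.
have j0 : (j * 3 <= `|pmax v t - (v + 1)%R|)%N by apply: leq_divM.
apply: mulr_ge0; first by apply: exprn_ge0; lra.
by apply: block_ge0 => //; lia.
Qed.

(** At the first visit to [y + 3] the old block ends with value 1 and the new one starts with
    [(288 / 281) * warm 2 = 1], so [climb] matches across blocks and [block_step] suffices. *)
Lemma superharmonic_climb v :
  superharmonic (fun t => nnpath v t && (v < pmax v t)) (climb v).
Proof.
move=> t /andP[ht hm] /=.
set j := (`|pmax v t - (v + 1)%R| %/ 3)%N.
have j0 : (j * 3 <= `|pmax v t - (v + 1)%R|)%N by apply: leq_divM.
have j1 : (`|pmax v t - (v + 1)%R| < j * 3 + 3)%N by rewrite -mulSnr; apply: ltn_ceil.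
set y := v + 1 + (j * 3)%:Z.
have ym : y <= pmax v t by lia.
have my : pmax v t < y + 3 by lia.
have vy : v < y by lia.
have hx := head_pmax ht.
have E (z : int) : z = hd t + 1 \/ z = hd t - 1 ->
    killed (fun t => nnpath v t && (v < pmax v t)) (climb v) (z :: t) =
    (288 / 281) ^+ j * block_exit v y (z :: t).
  move=> hz; rewrite /killed nnpath_cons // adjP pmax_cons.
  have -> : (z == hd t + 1) || (z == hd t - 1) by lia.
  have -> : (v < Num.max z (pmax v t)) = true by lia.
  rewrite /climb /block_exit /=; have [zy|zy] := eqVneq z (y + 3).
    have -> : (`|pmax v (z :: t) - (v + 1)%R| = j.+1 * 3)%N.
      by rewrite pmax_cons; lia.
    rewrite mulnK // (_ : v + 1 + _ = y + 3); last lia.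
    rewrite /block pmax_cons (_ : Num.max _ _ == _); last lia.
    rewrite occ_cons /= zy eqxx ltxx addn0 (@occ_unvisited v) //.
    by rewrite warm2 exprSr -mulrA; congr (_ * _); lra.
  have -> : (`|pmax v (z :: t) - (v + 1)%R| %/ 3 = j)%N.
    by move: j0 j1 ym my zy; rewrite pmax_cons /y; move: {y vy} j => j; lia.
  by [].
rewrite !E; [|by right|by left].
rewrite /climb -/j -/y mulrCA [X in _ + X <= _]mulrCA -mulrDr -mulrA.
apply: ler_wpM2l; first by apply: exprn_ge0; lra.
exact: block_step ht vy ym my.
Qed.

Lemma climb_new_max v y t j : nnpath v (y :: t) -> pmax v t < y ->
  y = v + 1 + (j * 3)%:Z -> climb v (y :: t) = (288 / 281) ^+ j * warm R 2.
Proof.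
move=> ht hy yj; rewrite /climb.
have hm : pmax v (y :: t) = y by rewrite pmax_cons; lia.
rewrite hm (_ : `|y - (v + 1)%R| = j * 3)%N; last lia.
rewrite mulnK // -yj /block hm eqxx occ_cons /= eqxx ltxx addn0.
case: t ht hy {hm} => [|z t] ht hy; first by [].
by rewrite (@occ_unvisited v) //; case/andP: ht.
Qed.

End climbing.

(** * Cylinder probabilities and the maximal inequality *)

Section vrrw_law.
Context d (T : measurableType d) (R : realType) (P : probability T R).
Implicit Types (X : nat -> T -> int) (v p y : int) (s : seq int).

(** The list has length [n]: the path up to time [n] is [hist X n.+1 w]. *)
Fixpoint hist X n w : seq int := if n is m.+1 then X m w :: hist X m w else [::].

Definition cyl X s : set T := [set w | hist X (size s) w = s].

Definition kern s y : R :=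
  (Z_adjacent y (hd s))%:R *
  ((occ s y)%:R / ((occ s (hd s + 1))%:R + (occ s (hd s - 1))%:R)).

Definition vrrw_law X v :=
  [/\ forall n y, measurable (X n @^-1` [set y]),
      P.-negligible [set w | X 0%N w <> v] &
      forall s y, s <> [::] -> P (cyl X (y :: s)) = (P (cyl X s) * (kern s y)%:E)%E].

Definition nn_walk X v w := X 0%N w = v /\ forall n, Z_adjacent (X n.+1 w) (X n w).

Lemma size_hist X n w : size (hist X n w) = n.
Proof. by elim: n => //= n ->. Qed.

Lemma nnpath_hist X v w n : nn_walk X v w -> nnpath v (hist X n.+1 w).
Proof.
move=> [X0 adj]; elim: n => [|n IH]; first by rewrite /= X0 eqxx.
by rewrite -[hist _ _ _]/(X n.+1 w :: hist X n.+1 w) nnpath_cons //; exact: adj.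
Qed.

Lemma cyl_cons X y s : cyl X (y :: s) = X (size s) @^-1` [set y] `&` cyl X s.
Proof. by rewrite /cyl; apply/seteqP; split => w /= [-> ->]. Qed.

Lemma negligible_countable (I : countType) (F : I -> set T) :
  (forall i, P.-negligible (F i)) -> P.-negligible (\bigcup_i F i).
Proof.
move=> h; pose G n := if choice.unpickle n is Some i then F i else set0.
apply: (@negligibleS _ _ _ _ (\bigcup_n G n)).
  by move=> w [i _ Fi]; exists (choice.pickle i) => //; rewrite /G choice.pickleK.
apply: negligible_bigcup => n; rewrite /G; case: choice.unpickle => //.
exact: negligible_set0.
Qed.

Section one_walk.
Variables (X : nat -> T -> int) (v : int).
Hypothesis hX : vrrw_law X v.

Lemma measurable_cyl s : measurable (cyl X s).
Proof.
elim: s => [|y s IH]; first by rewrite (_ : cyl _ _ = setT) //; apply/seteqP; split.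
by rewrite cyl_cons; apply: measurableI => //; case: hX.
Qed.

(** A forbidden jump lies in one of countably many cylinders whose last transition has kernel 0. *)
Lemma nn_walk_ae : P.-negligible [set w | ~ nn_walk X v w].
Proof.
have [_ X0 XS] := hX.
pose F (u : seq int * int) :=
  if (u.1 != [::]) && ~~ Z_adjacent u.2 (hd u.1) then cyl X (u.2 :: u.1) else set0.
apply: (@negligibleS _ _ _ _ ([set w | X 0%N w <> v] `|` \bigcup_u F u)).
  move=> w /not_andP[|/existsNP[n /negP hn]]; first by left.
  right; exists (hist X n.+1 w, X n.+1 w) => //.
  by rewrite /F /= hn /cyl /= size_hist.
apply: negligibleU => //; apply: negligible_countable => -[s y]; rewrite /F /=.
case: ifP => [/andP[/eqP s0 /negbTE hs]|_]; last exact: negligible_set0.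
apply/negligibleP; first exact: measurable_cyl.
by apply: etrans (XS _ _ s0) _; rewrite /kern hs mul0r mule0.
Qed.

(** Within [m] steps after [s], and inside [D], the level [L] is attained: a finite union of
    cylinders, suited to induction on [m]. *)
Fixpoint reach (D : pred (seq int)) (V : seq int -> R) (L : R) m s : set T :=
  if D s then
    if L <= V s then cyl X s
    else if m is m'.+1 then
      reach D V L m' (hd s + 1 :: s) `|` reach D V L m' (hd s - 1 :: s)
    else set0
  else set0.

Lemma measurable_reach D V L m s : measurable (reach D V L m s).
Proof.
elim: m s => [|m IH] s /=; do 2?case: ifP => _ //; try exact: measurable_cyl.
exact: measurableU.
Qed.

Lemma reach_mono D V L m s : reach D V L m s `<=` reach D V L m.+1 s.
Proof.
elim: m s => [|m IH] s w; first by move=> /=; case: ifP => // _; case: ifP.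
rewrite -[reach D V L m.+2 s]/(if D s then if L <= V s then cyl X s else
  reach D V L m.+1 (hd s + 1 :: s) `|` reach D V L m.+1 (hd s - 1 :: s) else set0).
rewrite {1}/reach -/reach; case: ifP => // _; case: ifP => // _.
by apply: setUSS; exact: IH.
Qed.

Lemma cyl_fin s : P (cyl X s) = (fine (P (cyl X s)))%:E.
Proof. by rewrite fineK // fin_num_measure //; exact: measurable_cyl. Qed.

Section maximal_inequality.
Variables (D : pred (seq int)) (V : seq int -> R).
Hypothesis V_ge0 : forall s, D s -> 0 <= V s.
Hypothesis V_super : superharmonic D V.

(** The maximal inequality started from [s]: the two one-step bounds average, with weights [kern],
    to at most [V s / L]. *)
Lemma P_reach L m s : 0 < L -> s <> [::] ->
  (P (reach D V L m s) <= (fine (P (cyl X s)) * (killed D V s / L))%:E)%E.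
Proof.
move=> L0; elim: m s => [|m IH] s s0 /=.
  rewrite /killed; case: ifP => Ds; last by rewrite measure0 mul0r mulr0.
  case: ifP => LV; last first.
    by rewrite measure0 lee_fin mulr_ge0 ?fine_ge0 // divr_ge0 ?V_ge0 ?ltW.
  rewrite [leLHS]cyl_fin lee_fin ler_peMr ?fine_ge0 //.
  by rewrite ler_pdivlMr // mul1r.
rewrite /killed; case: ifP => Ds; last by rewrite measure0 mul0r mulr0.
case: ifP => LV.
  rewrite [leLHS]cyl_fin lee_fin ler_peMr ?fine_ge0 //.
  by rewrite ler_pdivlMr // mul1r.
apply: (le_trans (measureU2 _ _ _)); [exact: measurable_reach..|].
apply: le_trans (leeD (IH _ _) (IH _ _)) _ => //.
have [_ _ XS] := hX.
rewrite !XS // cyl_fin -!EFinM /= -EFinD lee_fin -!mulrA -mulrDr.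
apply: ler_wpM2l; first exact: fine_ge0.
rewrite !mulrA -mulrDl ler_pM2r ?invr_gt0 //.
have := V_super Ds => /=.
rewrite /kern !adjP !eqxx /= orbT !mul1r.
set r : R := (occ s (hd s + 1))%:R; set l : R := (occ s (hd s - 1))%:R.
have r1 : 1 <= r by rewrite (ler_nat _ 1).
have l1 : 1 <= l by rewrite (ler_nat _ 1).
rewrite -ler_pdivrMr; last by lra.
by rewrite mulrDl ![_ / (r + l)]mulrAC [l / _ * _]mulrAC.
Qed.

Lemma reach_subset L m s w n : cyl X s w -> (forall n, Z_adjacent (X n.+1 w) (X n w)) ->
  s <> [::] ->
  (forall k, (size s <= k)%N -> D (hist X k w)) -> (size s <= n <= size s + m)%N ->
  L <= V (hist X n w) -> reach D V L m s w.
Proof.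
move=> hs adj s0 DX; elim: m s hs s0 DX => [|m IH] s hs s0 DX.
  by rewrite addn0 -eqn_leq => /eqP <-; rewrite hs /= -{2}hs DX // => ->.
move=> /andP[n1 n2] hL /=; rewrite -{1}hs DX //.
case: ifP => LV //.
have [ns|ns] := eqVneq n (size s); first by move: hL; rewrite ns hs LV.
have hn : cyl X (X (size s) w :: s) w by rewrite cyl_cons.
have hsn : (size s <= n)%N && (n != size s) by rewrite n1 ns.
have sz : hd s = X (size s).-1 w.
  by move: hs s0; rewrite /cyl /=; case: (s) => //= y s' [<-].
have := adj (size s).-1; rewrite prednK; last by case: (s) s0.
rewrite -sz adjP => /orP[] /eqP hy; [left|right]; rewrite -hy; apply: IH => //=.
- by move=> k hk; apply: DX; exact: ltnW.
- by move: n1 n2 ns; lia.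
- by move=> k hk; apply: DX; exact: ltnW.
- by move: n1 n2 ns; lia.
Qed.

(** The bound of [P_reach] is uniform in the horizon [m], so it passes to the increasing union [B L]
    and gives [c / (L + 1)], which tends to 0. *)
Lemma unbounded_negligible s : s <> [::] -> P.-negligible
  [set w | [/\ nn_walk X v w, cyl X s w,
    forall k, (size s <= k)%N -> D (hist X k w) &
    forall L, exists2 n, (size s <= n)%N & L <= V (hist X n w)]].
Proof.
move=> s0; pose B (L : nat) := \bigcup_m reach D V (L.+1)%:R m s.
have mB L : measurable (B L).
  by apply: bigcup_measurable => m _; exact: measurable_reach.
exists (\bigcap_L B L); split.
- exact: bigcap_measurable.
- apply/eqP; rewrite -measure_le0; apply/lee_addgt0Pr => e e0; rewrite add0e.
  pose c := fine (P (cyl X s)) * killed D V s.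
  have c0 : 0 <= c.
    by rewrite mulr_ge0 ?fine_ge0 // /killed; case: ifP => // /V_ge0.
  pose L := Num.truncn (c / e).
  have hL : c / (L.+1)%:R <= e.
    rewrite ler_pdivrMr // mulrC -ler_pdivrMr //.
    by apply/ltW; rewrite truncnS_gt.
  apply: (@le_trans _ _ (P (B L))).
    apply: le_measure; rewrite ?inE //; last by move=> w; exact.
    exact: bigcap_measurable.
  apply: (@le_trans _ _ (c / (L.+1)%:R)%:E); last by rewrite lee_fin.
  have hc : (P (reach D V L.+1%:R x s) @[x --> \oo] --> P (B L))%classic.
    apply: nondecreasing_cvg_mu; [|exact: mB|].
      by move=> m; exact: measurable_reach.
    move=> i j ij; apply/subsetPset; move: i j ij.
    apply: (@homo_leq _ _ (fun E F => E `<=` F)) => [E //|E F G EF FG|m].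
      exact: subset_trans EF FG.
    exact: reach_mono.
  rewrite -(cvg_lim _ hc) //; apply: lime_le; first by apply/cvg_ex; exists (P (B L)).
  by apply: nearW => m; rewrite /c -mulrA; exact: P_reach.
- move=> w [[_ adj] ws DX hV] L _; have [n n1 n2] := hV (L.+1)%:R.
  exists (n - size s)%N => //; apply: (@reach_subset _ _ _ _ n) => //.
  by rewrite n1 subnKC // leqnn.
Qed.

(** There are only countably many initial paths [s] after which [D] may hold for good. *)
Lemma supermartingale_bounded : P.-negligible
  [set w | nn_walk X v w /\ exists N,
    (forall k, (N < k)%N -> D (hist X k w)) /\
    (forall L, exists2 n, (N < n)%N & L <= V (hist X n w))].
Proof.
pose A s := if s == [::] then set0 else
  [set w | [/\ nn_walk X v w, cyl X s w,
    forall k, (size s <= k)%N -> D (hist X k w) &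
    forall L, exists2 n, (size s <= n)%N & L <= V (hist X n w)]].
apply: (@negligibleS _ _ _ _ (\bigcup_s A s)); last first.
  apply: negligible_countable => s; rewrite /A; case: eqP => s0.
    exact: negligible_set0.
  exact: unbounded_negligible.
move=> w [hw [N [DN VN]]]; exists (hist X N.+1 w) => //; rewrite /A /=.
by split => //; rewrite ?/cyl /= size_hist.
Qed.

End maximal_inequality.

Lemma hist_pmax w i n : (i < n)%N -> X i w <= pmax v (hist X n w).
Proof.
elim: n => // n IH; rewrite ltnS leq_eqVlt => /orP[/eqP ->|/IH] /=; lia.
Qed.

Lemma pmax_hist_lt w n y : v < y -> (forall i, (i < n)%N -> X i w < y) ->
  pmax v (hist X n w) < y.
Proof.
move=> vy; elim: n => //= n IH h.
have h1 := h n (leqnn _); have h2 : pmax v (hist X n w) < y.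
  by apply: IH => i ilt; apply: h; exact: ltnW.
lia.
Qed.

Lemma unbounded_above_negligible :
  P.-negligible [set w | nn_walk X v w /\ forall K : int, exists n, K <= X n w].
Proof.
have V0 t : nnpath v t && (v < pmax v t) -> 0 <= climb R v t.
  by move=> /andP[ht hm]; exact: climb_ge0.
have := supermartingale_bounded V0 (@superharmonic_climb R v); apply: negligibleS.
move=> w [hw unb]; split => //; have [n0 hn0] := unb (v + 1).
exists n0; split.
  move=> k hk; apply/andP; split; last by have := hist_pmax w hk; lia.
  by case: k hk => // k _; exact: nnpath_hist.
move=> L.
(* Bernoulli's inequality with [288 / 281 = 1 + 7 / 281]. *)
have growth j : j%:R * (7 / 281) <= (288 / 281) ^+ j :> R.
  elim: j => [|j IH]; first by rewrite mul0r expr0 ler01.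
  rewrite exprS -natr1.
  have : 1 <= (288 / 281) ^+ j :> R by apply: exprn_ege1; lra.
  by move: IH; set q := _ ^+ j; set z := j%:R; lra.
(* Since [42 > 288 / 7], the first entry makes [climb] exceed [L]; the second puts [y] beyond all
   sites seen up to time [n0]. *)
pose j := maxn (Num.truncn (42 * L)).+1 `|pmax v (hist X n0.+1 w) - v|%N.
pose y := v + 1 + (j * 3)%:Z.
have [n1 hn1] := unb y.
have [m hm mmin] := ex_minnP (ex_intro (fun n => y <= X n w) n1 hn1).
have before i : (i < m)%N -> X i w < y.
  by move=> im; rewrite ltNge; apply/negP => /mmin; rewrite leqNgt im.
have vy : v < y by lia.
have my : X m w = y.
  case: m hm {mmin} before => [|m] hm before; first by move: hm; rewrite hw.1; lia.
  by have := before m (leqnn _); have := hw.2 m; rewrite adjP; lia.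
have hp := pmax_hist_lt vy before.
exists m.+1.
  rewrite ltnS leqNgt; apply/negP => mn.
  have : X m w <= pmax v (hist X n0.+1 w) by apply: hist_pmax; lia.
  have : (`|pmax v (hist X n0.+1 w) - v| <= j)%N by exact: leq_maxr.
  by rewrite my /y; lia.
rewrite (_ : hist _ _ _ = y :: hist X m w) /=; last by rewrite my.
rewrite (@climb_new_max _ _ _ _ j) // ?warm2; last first.
  by rewrite -my -[_ :: _]/(hist X m.+1 w); exact: nnpath_hist.
have h1 := growth j.
have h2 : 42 * L < j%:R.
  apply: lt_le_trans (truncnS_gt _) _; rewrite ler_nat; exact: leq_maxl.
have h3 : 0 <= j%:R :> R by [].
move: h1 h2 h3; set q := _ ^+ j; set z := j%:R; lra.
Qed.

End one_walk.
End vrrw_law.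

(** * Escape from windows of three and four sites *)

Lemma slow_harmonic_unbounded (R : realType) C (L : R) :
  exists k, forall k', (k <= k')%N -> L <= slow_harmonic R C k'.
Proof.
have mono : {homo slow_harmonic R C : m n / (m <= n)%N >-> m <= n}.
  apply: homo_leq => // [|k]; first exact: le_trans.
  by rewrite slow_harmonicS lerDl invr_ge0 mulr_ge0.
have [[k hk]|/forallNP bnd] := pselect (exists k, L <= slow_harmonic R C k).
  by exists k => k' /mono; exact: le_trans.
exfalso; apply: (@dvg_harmonic R); apply: nondecreasing_is_cvgn.
  by apply/nondecreasing_seqP => n; rewrite seriesSr lerDl harmonic_ge0.
(* A bound [L] here would bound the harmonic partial sums by [(C + 1) L]. *)
exists ((C.+1)%:R * L) => _ [n _ <-].
have /negP := bnd n; rewrite -ltNge => /ltW h.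
have : \sum_(i < n) ((C.+1)%:R * (i.+1)%:R)^-1 <= L.
  by apply: le_trans h; rewrite /slow_harmonic lerDr.
rewrite seriesEord /= /harmonic /= => hs.
rewrite -ler_pdivrMl // mulr_sumr; apply: le_trans hs.
by apply: ler_sum => i _; rewrite invfM.
Qed.

Section window_escape.
Context d (T : measurableType d) (R : realType) (P : probability T R).
Variables (X : nat -> T -> int) (v : int).
Hypothesis hX : vrrw_law P X v.

Lemma occ_hist_mono w y m n : (m <= n)%N -> (occ (hist X m w) y <= occ (hist X n w) y)%N.
Proof.
move=> /subnK <-; elim: (n - m)%N => // k IH.
by rewrite addSn /= occ_cons (leq_trans IH) // leq_addl.
Qed.

Lemma occ_hist_frozen w (y : int) N : (forall n, (N <= n)%N -> X n w != y) ->
  forall n, (occ (hist X n w) y <= N.+1)%N.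
Proof.
move=> h; elim=> // n IH; rewrite /= occ_cons.
have [Nn|nN] := leqP N n; first by rewrite (negbTE (h n Nn)).
have : (count_mem y (hist X n w) <= n)%N.
  by rewrite -[X in (_ <= X)%N](size_hist X n w) count_size.
by rewrite /occ; case: (_ == _) => /=; lia.
Qed.

Lemma occ_window4 w (p : int) N : (forall n, (N <= n)%N -> p <= X n w <= p + 3) ->
  forall n, (n <= N + (occ (hist X n w) p + occ (hist X n w) (p + 1)%R +
                   occ (hist X n w) (p + 2)%R + occ (hist X n w) (p + 3)%R))%N.
Proof.
move=> h; elim=> //= n IH; rewrite !occ_cons.
have [Nn|nN] := leqP N n; last by lia.
by have := h n Nn; move: IH; lia.
Qed.

Lemma window3_negligible (p : int) :
  P.-negligible [set w | nn_walk X v w /\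
    exists N, forall n, (N <= n)%N -> p <= X n w <= p + 2].
Proof.
have V0 t : window3 p t -> 0 <= (occ t (p + 1))%:R :> R by [].
have := supermartingale_bounded hX V0 (@superharmonic_window3 R p); apply: negligibleS.
move=> w [hw [N hN]]; split => //; exists N; split.
  by case=> // k; rewrite ltnS => /hN.
(* The sites [p - 1] and [p + 3] are frozen, so counting steps gives
   [m + 1 <= 4 N + 3 + 3 Z(p + 1)]. *)
move=> L; have [m hm] : {m | m = (4 * N + 3 + 3 * (Num.truncn L).+1)%N} by eexists.
exists m.+1; first by lia.
apply: ltW; apply: lt_le_trans (truncnS_gt _) _; rewrite ler_nat.
have h4 n : (N <= n)%N -> p <= X n w <= p + 3 by move=> /hN; lia.
have hs := nnpath_hist m hw.
have hl n : (N <= n)%N -> X n w != p - 1 by move=> /hN; lia.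
have hr n : (N <= n)%N -> X n w != p + 3 by move=> /hN; lia.
have := occ_neighbors p hs; have := occ_neighbors (p + 2) hs.
have := occ_hist_frozen hl m.+1; have := occ_hist_frozen hr m.+1.
have -> : p + 2 - 1 = p + 1 by lia.
have -> : p + 2 + 1 = p + 3 by lia.
have := occ_window4 h4 m.+1.
by move: hm; move: (Num.truncn L) (hist X m.+1 w) => c H; lia.
Qed.

Lemma window4_negligible (p : int) :
  P.-negligible [set w | nn_walk X v w /\
    exists N, forall n, (N <= n)%N -> p <= X n w <= p + 3].
Proof.
have U0 t : window4 p t && (1 < occ t p)%N ->
    0 <= (occ t (p + 2))%:R / ((occ t p)%:R - 1) :> R.
  by move=> /andP[_ h]; rewrite divr_ge0 // subr_ge0 (ler_nat _ 1) ltnW.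
have W0 C t : [&& nnpath v t, window4 p t & (occ t (p + 2) <= C * (occ t p).-1)%N] ->
    0 <= slow_harmonic R C (occ t p - (hd t == p)).
  by move=> _; exact: le_trans (slow_harmonic_ge1 _ _ _).
have nU := supermartingale_bounded hX U0 (@superharmonic_ratio R p).
have nW := negligible_bigcup (fun C =>
  supermartingale_bounded hX (@W0 C) (@superharmonic_departures R v p C)).
have := negligibleU (window3_negligible (p + 1)) (negligibleU nU nW).
apply: negligibleS => w [hw [N hN]].
(* Without a visit to [p] after time [N], the walk is confined to three sites from [p + 1] on. *)
have [[n0 [Nn0 hn0]]|/forallNP hp] :=
    pselect (exists n, (N <= n)%N /\ X n w = p); last first.
  left; split => //; exists N => n Nn; have := hN n Nn.
  by have : X n w <> p; [move=> e; apply: (hp n) | lia].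
have hwin k : (n0 < k)%N -> window4 p (hist X k w).
  by case: k => // k k0; apply: hN; exact: leq_trans Nn0 _.
have hocc k : (n0 < k)%N -> (1 < occ (hist X k w) p)%N.
  move=> k0; apply: leq_trans (occ_hist_mono _ _ k0).
  by rewrite /= occ_cons hn0 eqxx.
right; have [hunb|/existsNP[L hL]] := pselect (forall L : R, exists2 n, (n0 < n)%N &
    L <= (occ (hist X n w) (p + 2))%:R / ((occ (hist X n w) p)%:R - 1)).
  left; split => //; exists n0; split => // k k0.
  by rewrite hwin // hocc.
right; pose C := (Num.truncn L).+1; exists C => //; split => //.
have hC k : (n0 < k)%N -> (occ (hist X k w) (p + 2) <= C * (occ (hist X k w) p).-1)%N.
  move=> k0; have o1 := hocc k k0.
  rewrite leqNgt; apply/negP => lt; apply: hL; exists k => //.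
  rewrite ler_pdivlMr; last by rewrite subr_gt0 (ltr_nat _ 1).
  rewrite -(natrB _ (ltnW o1)) subn1.
  apply: le_trans (_ : (C * (occ (hist X k w) p).-1)%:R <= _); last by rewrite ler_nat ltnW.
  by rewrite natrM ler_wpM2r // ltW // truncnS_gt.
exists n0; split.
  move=> k k0; rewrite hwin // hC // !andbT.
  by case: k k0 => // k _; exact: nnpath_hist.
move=> L'; have [k hk] := slow_harmonic_unbounded C L'.
(* Elapsed time is at most [2 N + 1 + 2 Z(p) + 3 Z(p + 2)] with [Z(p + 2) <= C (Z(p) - 1)]; this [m]
   rules out [Z(p) <= k]. *)
pose m := (n0 + N + N + (3 + 3 * C) * k.+1)%N.
have hm : m = (n0 + N + N + (3 + 3 * C) * k.+1)%N by [].
have m0 : (n0 < m.+1)%N by lia.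
exists m.+1 => //.
apply: hk.
have h4 := occ_window4 hN m.+1.
have hs := nnpath_hist m hw.
have hr n : (N <= n)%N -> X n w != p + 4 by move=> /hN; lia.
have h5 := occ_hist_frozen hr m.+1.
have h6 := hC m.+1 m0; have := occ_neighbors (p + 1) hs.
have := occ_neighbors (p + 3) hs.
have -> : p + 1 - 1 = p by lia.
have -> : p + 1 + 1 = p + 2 by lia.
have -> : p + 3 - 1 = p + 2 by lia.
have -> : p + 3 + 1 = p + 4 by lia.
move: h4 h5 h6; set H := hist X m.+1 w => h4 h5 h6 h7 h8.
rewrite leqNgt; apply/negP => lt.
have ak : ((occ H p).-1 <= k)%N by lia.
have := leq_mul (leqnn C) ak; have := leq_mul (leqnn C) (leqnSn k).
by move: {hC} hm m0 h4 h5 h6 h7 h8 ak; nia.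
Qed.

End window_escape.

(** * Infinite sets and cardinality bounds *)

Lemma infinite_natP (A : set nat) :
  infinite_set A <-> forall N, exists2 n, (N <= n)%N & A n.
Proof.
split=> [infA N|h].
  apply: contrapT => /forall2NP hA; apply: infA.
  apply: (@sub_finite_set _ _ `I_N); last exact: finite_II.
  move=> n An /=; rewrite ltnNge; apply/negP => Nn.
  by case: (hA n) => // /negP; rewrite Nn.
move=> /finite_seqP[s hs]; have [n ns] := h (\max_(i <- s) i).+1.
rewrite hs /= => sn; move: ns; rewrite ltnNge => /negP; apply.
exact: leq_bigmax_seq.
Qed.

Lemma card_le_IIP (T : choiceType) (A : set T) n :
  A #<= `I_n <-> forall B : {fset T}, [set` B] `<=` A -> (#|` B| <= n)%N.
Proof.
split=> [An B BA|h].
  rewrite -(set_fsetK B); apply: geq_card_fset_set.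
  exact: card_le_trans (subset_card_le BA) An.
have [finA|infA] := pselect (finite_set A); last first.
  have [B BA nB] := infinite_set_fset n.+1 infA.
  by have := h B BA; rewrite leqNgt nB.
rewrite -(fset_setK finA).
have /card_eq_fsetP : #|` fset_set A| = #|` fset_set A| by [].
move=> /(@card_le_eql _ _ _ _ _) ->; rewrite card_le_II; apply: h.
by rewrite fset_setK.
Qed.

(** * Reflection, and cylinder probabilities from conditional ones *)

Section law.
Context d (T : measurableType d) (R : realType) (P : probability T R).

Lemma hist_opp (X : nat -> T -> int) n w :
  hist (fun n w => - X n w) n w = map -%R (hist X n w).
Proof. by elim: n => //= n ->. Qed.

(** Reflection reduces unboundedness below to unboundedness above. *)
Lemma vrrw_law_opp (X : nat -> T -> int) v :
  vrrw_law P X v -> vrrw_law P (fun n w => - X n w) (- v).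
Proof.
have oppK (s : seq int) : map -%R (map -%R s) = s.
  by rewrite -map_comp -[RHS]map_id; apply: eq_map => x /=; rewrite opprK.
have cyl_opp s : cyl (fun n w => - X n w) s = cyl X (map -%R s).
  apply/seteqP; split => w; rewrite /cyl /= hist_opp size_map.
    by move=> <-; rewrite oppK size_map size_hist.
  by move=> ->; rewrite oppK.
have hd_opp s : hd (map -%R s) = - hd s by case: s => //=; rewrite /hd oppr0.
have occ_opp s y : occ (map -%R s) y = occ s (- y).
  by rewrite /occ count_map; congr _.+1; apply: eq_count => x /=; lia.
move=> [mX X0 XS]; split.
- move=> n y; rewrite (_ : _ @^-1` _ = X n @^-1` [set - y]) //.
  by apply/seteqP; split => w /=; lia.
- apply: negligibleS X0 => w /= h e; apply: h; by rewrite e.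
- move=> s y s0; rewrite !cyl_opp /= XS; last by case: s s0.
  congr (_ * _%:E)%E; rewrite /kern hd_opp !occ_opp opprK !opprD !opprK.
  by rewrite [X in _ / X]addrC !adjP; congr ((_ : bool)%:R * _); lia.
Qed.

Variables (X : nat -> {RV P >-> int}) (v : int).
Hypothesis hX : is_vrrw X v.

Let Y n w := X n w : int.

Lemma measurable_visit n y : measurable (Y n @^-1` [set y]).
Proof.
exact: (measurable_funPTI (X n)).
Qed.

Lemma aug_occupationE n x w : aug_occupation X n x w = occ (hist Y n.+1 w) x.
Proof.
rewrite /aug_occupation /occ add1n; congr _.+1.
by elim: n.+1 => [|m IH]; rewrite ?big_ord0 //= big_ord_recr /= IH addnC.
Qed.

Lemma vrrw_kernelE n y w : vrrw_kernel X n y w = kern R (hist Y n.+1 w) y.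
Proof.
rewrite /vrrw_kernel /kern aug_occupationE; congr (_ * (_ / _)).
set x := hd _.
have -> : [set y0 | Z_adjacent y0 (X n w)] = [set` [:: x + 1; x - 1]].
  apply/seteqP; split => z /=; rewrite adjP !inE; exact.
rewrite -fsbig_seq /=; last by rewrite inE; lia.
by rewrite !big_cons big_nil addr0 !aug_occupationE.
Qed.

Lemma natural_filtration_cyl s n : (size s <= n.+1)%N ->
  natural_filtration X n (cyl Y s).
Proof.
set G := natural_filtration X n.
have GT : G setT by apply: (@measurableT _ (g_sigma_algebraType _)).
have GI A B : G A -> G B -> G (A `&` B) by apply: (@measurableI _ (g_sigma_algebraType _)).
elim: s => [_|y s IH sn].
  by rewrite (_ : cyl _ _ = setT) //; apply/seteqP; split.
rewrite cyl_cons; apply: GI; last by apply: IH; exact: ltnW.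
apply: sub_sigma_algebra; rewrite (bigD1 (Ordinal sn)) //=; left.
by exists [set y] => //; rewrite setTI.
Qed.

(** The kernel is constant on a cylinder of length [n + 1], which belongs to the sigma-algebra at
    time [n]; integrating over it gives the product formula. *)
Lemma vrrw_law_of : vrrw_law P Y v.
Proof.
have [X0 XS] := hX; split; first exact: measurable_visit.
  by apply: negligibleS X0.
move=> [//|z s] y _; set t := z :: s.
have [_ _ /(_ (cyl Y t))] := XS (size s) y.
rewrite -/(cyl Y (y :: t)) cyl_cons => <-; last exact: natural_filtration_cyl.
have mc : measurable (cyl Y t).
  elim: t => [|u t IH]; first by rewrite (_ : cyl _ _ = setT) //; apply/seteqP; split.
  by rewrite cyl_cons; apply: measurableI => //; exact: measurable_visit.
rewrite muleC -integral_cst //; apply: eq_integral => w /set_mem hw.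
by rewrite vrrw_kernelE -[in RHS]hw.
Qed.

End law.

(** * From at most four recurrent sites to a window of four sites *)

(* A nearest-neighbour walk that visits [k] infinitely often stays between any two
   sites, on either side of [k], that it visits only finitely often. *)
Lemma eventually_window4 d (T : measurableType d) (X : nat -> T -> int) v w :
  nn_walk X v w -> (exists K : int, forall n, X n w <= K) ->
  (exists K : int, forall n, K <= X n w) ->
  [set k | infinite_set [set n | X n w = k]] #<= `I_4 ->
  exists p N, forall n, (N <= n)%N -> p <= X n w <= p + 3.
Proof.
move=> [_ adj] [hi hhi] [lo hlo] card4.
set E := [set k | _] in card4.
have [m hm] : {m | m = `|hi - lo|.+1}%N by eexists.
have [k _ [A infA kA]] : exists2 k, True &
    exists2 A, infinite_set A & forall n, A n <-> X n w = k.
  have : finite_set (range (fun n => X n w)).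
    apply: (@sub_finite_set _ _ [set` [seq lo + i%:Z | i <- iota 0 m]]);
      last exact: finite_seq.
    move=> _ [n _ <-] /=; apply/mapP; exists `|X n w - lo|%N.
      by rewrite mem_iota; have := hhi n; have := hlo n; lia.
    by have := hlo n; lia.
  by move=> /finite_range_cst_subsequence[k [A h1 h2]]; exists k => //; exists A.
have Ek : E k by apply: sub_infinite_set infA => n /kA.
(* Five consecutive sites cannot all lie in a set of at most four elements. *)
have five (j : int) : exists2 i, (i < 5)%N & ~ E (j + i%:Z).
  apply: contrapT => /forall2NP h.
  have hE i : (i < 5)%N -> E (j + i%:Z).
    by move=> i5; apply: contrapT => hi'; case: (h i).
  have [I hI] : {I | I = iota 0 5} by eexists.
  have /card_le_IIP /(_ [fset x in [seq (j + i%:Z)%R | i <- I]]%fset) := card4.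
  rewrite card_fseq undup_id ?size_map; last first.
    by rewrite map_inj_uniq ?hI ?iota_uniq // => x y; lia.
  have sub : [set` [fset x in [seq (j + i%:Z)%R | i <- I]]%fset] `<=` E.
    move=> x /=; rewrite inE /= => /mapP[i]; rewrite hI mem_iota => i5 ->.
    by apply: hE; lia.
  by move=> /(_ sub); rewrite hI.
have frozen (j : int) : ~ E j -> exists N, forall n, (N <= n)%N -> X n w != j.
  move=> hj; apply: contrapT => /forallNP h; apply: hj; apply/infinite_natP => N.
  have /existsNP[n /not_implyP[Nn /negP]] := h N.
  by rewrite negbK => /eqP e; exists n.
have [i0 i05 hi0] := five k.
(* [r = k + i] is the nearest site right of [k] outside [E]. One of the five sites before [r] is
   also outside [E], and by minimality it lies left of [k]; at most four sites remain in between. *)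
have [i /asboolP iE imin] := ex_minnP (ex_intro (fun i => `[< ~ E (k + i%:Z) >]) i0 (asboolT hi0)).
have i5 : (i < 5)%N by apply: leq_ltn_trans i05; apply: imin; apply/asboolP.
have [j j5 jE] := five (k + i%:Z - 5).
have jk : k + i%:Z - 5 + j%:Z < k.
  rewrite ltNge; apply/negP => kj.
  have e : k + i%:Z - 5 + j%:Z = k + (i + j - 5)%N%:Z by lia.
  have := imin (i + j - 5)%N; rewrite -e => /(_ (asboolT jE)); lia.
have ik : k < k + i%:Z by case: (i) iE => [|?] iE; [case: iE; rewrite addr0 | lia].
set r := k + i%:Z in iE ik jE jk; set l := r - 5 + j%:Z in jE jk.
have [N1 hN1] := frozen _ iE; have [N2 hN2] := frozen _ jE.
have [n0 hn0 Xn0] := (infinite_natP _).1 Ek (maxn N1 N2).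
have lr : r <= l + 5 by rewrite /l; lia.
suff between n : (n0 <= n)%N -> l < X n w < r.
  by exists (l + 1), n0 => n /between; move: lr; lia.
elim: n => [|n IH] hn.
  by move: Xn0; rewrite (_ : n0 = 0%N) /=; lia.
have [n0n|nn0] := eqVneq n0 n.+1.
  by move: Xn0; rewrite n0n /=; lia.
have n0n : (n0 <= n)%N by lia.
have h1 : X n.+1 w != r by apply: hN1; lia.
have h2 : X n.+1 w != l by apply: hN2; lia.
by move: h1 h2 (IH n0n) (adj n); rewrite adjP; lia.
Qed.

(** Infinitely many visits form a limsup event, and the cardinality bound is tested on the countably
    many finite sets of sites. *)
Lemma measurable_card_essential_range d (T : measurableType d) (X : nat -> T -> int) n :
  (forall m y, measurable (X m @^-1` [set y])) ->
  measurable [set w | [set k | infinite_set [set m | X m w = k]] #<= `I_n].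
Proof.
move=> mX; set E := fun k w => infinite_set [set m | X m w = k].
have mE k : measurable (E k).
  rewrite (_ : E k = \bigcap_N \bigcup_(m in [set m | (N <= m)%N]) (X m @^-1` [set k])).
    by apply: bigcap_measurable => // N _; exact: bigcup_measurable.
  apply/seteqP; split => w.
    by move=> /infinite_natP h N _; have [m Nm Xm] := h N; exists m.
  by move=> h; apply/infinite_natP => N; have [m Nm Xm] := h N I; exists m.
rewrite (_ : [set w | _] =
  \bigcap_(B : {fset int}) if (#|` B| <= n)%N then setT else ~` \bigcap_(k in [set` B]) E k).
  rewrite -[X in measurable X]setCK setC_bigcap; apply: measurableC.
  apply: countable_bigcupT_measurable => // B; apply: measurableC.
  case: ifP => _ //; apply: measurableC.
  by apply: fin_bigcap_measurable => //; exact: finite_fset.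
apply/seteqP; split => w /=.
  move=> /card_le_IIP h B _; case: ifPn => // /negP hB BE; apply: hB; apply: h.
  by move=> k kB; exact: BE.
move=> h; apply/card_le_IIP => B BE; by have := h B I; case: ifP.
Qed.

Theorem theorem1p2 (d : measure_display) (T : measurableType d) (R : realType)
    (P : probability T R) (X : nat -> {RV P >-> int}) (v : int)
    (hX : is_vrrw X v) :
  P [set w | essential_range X w #<= `I_4] = 0%E.
Proof.
apply: measure_negligible.
  by apply: measurable_card_essential_range => m y; exact: measurable_visit.
have lX := vrrw_law_of hX; have lN := vrrw_law_opp lX.
(* The exceptional events: a forbidden jump, unboundedness above or below, and eventual confinement
   to some window of four sites. *)
have := negligibleU (nn_walk_ae lX) (negligibleU
  (negligibleU (unbounded_above_negligible lX) (unbounded_above_negligible lN))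
  (negligible_countable (fun p : int => window4_negligible lX p))).
apply: negligibleS => w /= card4.
have [hw|] := pselect (nn_walk (fun n w => X n w : int) v w); last by left.
right; have [[hi hhi]|/forallNP nhi] := pselect (exists K : int, forall n, X n w <= K); last first.
  left; left; split => // K; have /existsNP[n hn] := nhi K; exists n.
  by move/negP: hn; rewrite -ltNge => /ltW.
have [[lo hlo]|/forallNP nlo] := pselect (exists K : int, forall n, K <= X n w); last first.
  left; right; split.
    by case: hw => X0 adj; split=> [|n]; [rewrite X0 | have := adj n; rewrite !adjP; lia].
  move=> K; have /existsNP[n hn] := nlo (- K); exists n.
  by move/negP: hn; lia.
right; have [p [N hN]] := eventually_window4 hw (ex_intro _ hi hhi) (ex_intro _ lo hlo) card4.
by exists p => //; split => //; exists N.
Qed.
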